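(* For every odd positive integer $d$ and every integer $\chi$ there exists $N$ (depending only on $d$ and $|\chi|$) such that the following holds. Let $\mathbf{k}$ be a field and let $\Gamma$ be a $(d-1)$-dimensional homology manifold over $\mathbf{k}$ with Euler characteristic $\chi$ and $n\ge N$ vertices. Then $f_{d-1}(\Gamma)<\frac{1}{(n-d)!}\prod_{i=1}^{n-d}M_i(S/I_\Gamma)$; i.e., $\Gamma$ satisfies the multiplicity upper bound strictly.
   Context: A simplicial complex $\Gamma$ on $[n]$ is a family of subsets of $[n]$ closed under subsets containing all singletons; $f_i(\Gamma)$ is the number of faces of size $i+1$. The link of a face $F$ is $\mathrm{lk}_\Gamma(F)=\{G\setminus F: F\subseteq G\in\Gamma\}$. A $(d-1)$-dimensional $\Gamma$ is a homology manifold over $\mathbf{k}$ if for every nonempty face $F$, $\tilde H_{d-1-|F|}(\mathrm{lk}_\Gamma(F);\mathbf{k})\cong\mathbf{k}$ and $\tilde H_i(\mathrm{lk}_\Gamma(F);\mathbf{k})=0$ for $i<d-1-|F|$. The Euler characteristic is $\chi=\sum_{i=0}^{d-1}(-1)^i\beta_i(\Gamma)$ with non-reduced Betti numbers over $\mathbf{k}$. With $S=\mathbf{k}[x_1,\dots,x_n]$ and Stanley–Reisner ideal $I_\Gamma$ (generated by squarefree monomials of non-faces), $M_i(S/I_\Gamma)=\max\{j:\beta_{i,j}(S/I_\Gamma)\ne0\}$, equivalently $\max\{|W|:W\subseteq[n],\ \tilde H_{|W|-i-1}(\Gamma[W];\mathbf{k})\ne0\}$ with $\Gamma[W]$ the induced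 subcomplex. *)

(* Defs.v *)
From HB Require Import structures.
From mathcomp Require Import all_boot all_order all_algebra.
Set Implicit Arguments. Unset Strict Implicit. Unset Printing Implicit Defensive.
Import Order.TTheory GRing.Theory Num.Theory.

Section SC.
Variable n : nat.

Definition is_simplicial_complex (G : {set {set 'I_n}}) : Prop :=
  (forall F H : {set 'I_n}, F \in G -> H \subset F -> H \in G) /\ (forall v : 'I_n, [set v] \in G).

Definition faces (K : {set {set 'I_n}}) (j : nat) : {set {set 'I_n}} :=
  [set F in K | #|F| == j].

Definition fvec (K : {set {set 'I_n}}) (i : nat) : nat := #|faces K i.+1|.

Definition link (K : {set {set 'I_n}}) (F : {set 'I_n}) : {set {set 'I_n}} :=
  [set G :\: F | G in [set G in K | F \subset G]].

Definition induced (K : {set {set 'I_n}}) (W : {set 'I_n}) : {set {set 'I_n}} :=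
  [set G in K | G \subset W].

Variable k : fieldType.

(* simplicial boundary coefficient [F : G], vertices ordered as in [n] *)
Definition bd_entry (F G : {set 'I_n}) : k :=
  if (G \subset F) && (#|F :\: G| == 1)%N then
    (\sum_(v in F :\: G) (-1) ^+ #|[set u in G | (u < v)%N]|)%R
  else 0%R.

Definition bdmx (K : {set {set 'I_n}}) (j : nat) :
  'M[k]_(#|faces K j|, #|faces K j.-1|) :=
  \matrix_(a < #|faces K j|, b < #|faces K j.-1|)
     bd_entry (enum_val a) (enum_val b).

Definition rk_bd (K : {set {set 'I_n}}) (j : nat) : nat :=
  if j is 0 then 0 else \rank (bdmx K j).

(* dim_k of reduced homology H~_{j-1}(K; k) (the chain group in size j
   is spanned by faces of size j, the empty face giving the size-0 group) *)
Definition rhdim (K : {set {set 'I_n}}) (j : nat) : nat :=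
  (#|faces K j| - rk_bd K j - rk_bd K j.+1)%N.

(* non-reduced Betti number beta_i(K; k) = dim_k H_i(K; k) *)
Definition betti (K : {set {set 'I_n}}) (i : nat) : nat :=
  (#|faces K i.+1| - (if i is 0 then 0 else rk_bd K i.+1) - rk_bd K i.+2)%N.

Definition euler_char (K : {set {set 'I_n}}) (d : nat) : int :=
  \sum_(i < d) ((-1) ^+ i * (betti K i)%:Z)%R.

Definition homology_manifold (d : nat) (G : {set {set 'I_n}}) : Prop :=
  [/\ is_simplicial_complex G,
      (exists2 F : {set 'I_n}, F \in G & #|F| = d),
      (forall F : {set 'I_n}, F \in G -> #|F| <= d) &
      forall F : {set 'I_n}, F \in G -> F != set0 ->
        rhdim (link G F) (d - #|F|) = 1 /\
        forall j, j < d - #|F| -> rhdim (link G F) j = 0].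

(* M_i(S/I_G) via Hochster's formula:
   max{|W| : W subset [n], H~_{|W|-i-1}(G[W]; k) <> 0} *)
Definition Mmax (G : {set {set 'I_n}}) (i : nat) : nat :=
  \max_(W : {set 'I_n} | (i <= #|W|) && (rhdim (induced G W) (#|W| - i) != 0))
     #|W|.

End SC.

(* Main.v *)
Require Import Defs.
From HB Require Import structures.
From mathcomp Require Import all_boot all_order all_algebra.
From mathcomp Require Import zify ring.
Set Implicit Arguments. Unset Strict Implicit. Unset Printing Implicit Defensive.
Import Order.TTheory GRing.Theory Num.Theory.
Local Open Scope ring_scope.

(** Write d = 2m+1 and let f_i be the number of faces with i vertices.  The
    Dehn-Sommerville relations say that the polynomial
    g(x) = chi/2 + f_1 x + ... + f_d x^d satisfies g(-1-x) = -g(x).  Such a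
    polynomial of degree at most 2m+1 is determined by its coefficients up to
    x^m, because a multiple of x^(m+1) would also be one of (1+x)^(m+1); hence
    all f_i are bounded linearly in terms of |chi| and f_m.  In particular
    f_d = O(n^m), and f_(m+1) = O(f_m), so some face F with m vertices has a
    link on a bounded number B of vertices.

    Homology of an induced subcomplex of a link survives, without changing the
    homological index i, in an induced subcomplex of the whole complex on at
    least as many vertices.  The link of F is a homology m-sphere, and padding
    its vertex set by arbitrary vertices outside F yields M_i >= i + m + 1 for
    B <= i <= n - d.  So the product of the M_i divided by (n-d)! grows at
    least like n^(m+1), faster than f_d. *)

(** * Reduced homology of links and induced subcomplexes *)

Definition down_closed n (K : {set {set 'I_n}}) : Prop :=
  forall F H : {set 'I_n}, F \in K -> H \subset F -> H \in K.

Section Chains.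
Variables (n : nat) (k : fieldType).
Implicit Types (F G H W : {set 'I_n}) (K L : {set {set 'I_n}}) (u v : 'I_n).

Definition eps v G : k := (-1) ^+ #|[set u in G | (u < v)%N]|.

Lemma eps_sqr v G : eps v G * eps v G = 1.
Proof. by rewrite /eps -exprMn mulrNN mulr1 expr1n. Qed.

Lemma eps_setU1 u v G : u \notin G -> eps v (u |: G) = (-1) ^+ (u < v)%N * eps v G.
Proof.
move=> uG; rewrite /eps -exprD; congr (_ ^+ _).
have -> : [set w in u |: G | (w < v)%N] =
   (if (u < v)%N then u |: [set w in G | (w < v)%N] else [set w in G | (w < v)%N]).
  apply/setP=> w; rewrite !inE; case: ifP => uv; rewrite !inE;
  by have [->|] := eqVneq w u; rewrite ?uv ?andbF ?(negbTE uG).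
by case: ifP => uv //; rewrite cardsU1 inE (negbTE uG).
Qed.

Lemma eps_swap u v G : u != v -> u \notin G -> v \notin G ->
  eps u (v |: G) * eps v (u |: G) = - (eps v G * eps u G).
Proof.
move=> uv uG vG; rewrite !eps_setU1 //.
have : (v < u)%N = ~~ (u < v)%N by rewrite -leqNgt ltn_neqAle eq_sym (inj_eq val_inj) uv.
by move=> ->; case: (u < v)%N => /=; rewrite ?expr0 ?expr1; ring.
Qed.

(** Chains are functions on all vertex sets, with support imposed separately, so one boundary
    operator serves a complex, its links and its induced subcomplexes. *)
Definition bd (z : {set 'I_n} -> k) G : k :=
  \sum_(v | v \notin G) eps v G * z (v |: G).

Definition chain K j (z : {set 'I_n} -> k) : Prop :=
  forall F, z F != 0 -> F \in faces K j.

Lemma chain0 K j z F : chain K j z -> F \notin faces K j -> z F = 0.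
Proof. by move=> zK FK; apply: contraNeq FK => /zK. Qed.

Lemma bd_bd z G : bd (bd z) G = 0.
Proof.
rewrite /bd.
under eq_bigr => v vG.
  rewrite big_distrr /=.
  under eq_bigl => u do rewrite in_setU1 negb_or.
  over.
rewrite (exchange_big_dep (fun u => u \notin G)) /=; last by move=> i j _ /andP[].
set S := \sum_(_ | _) _.
pose T u v := eps v G * (eps u (v |: G) * z (u |: (v |: G))).
have S1 : S = \sum_(u | u \notin G) \sum_(v | (v \notin G) && (v != u)) T u v.
  by apply: eq_bigr => u uG; apply: eq_bigl => v; rewrite uG andbT eq_sym.
(* The (u, v) and (v, u) terms cancel; halving the sum by u < v keeps the
   argument valid in characteristic 2. *)
have S2 : S = \sum_(u | u \notin G) (\sum_(v | (v \notin G) && (v < u)%N) T u v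
      + \sum_(v | (v \notin G) && (u < v)%N) T u v).
  rewrite S1; apply: eq_bigr => u uG.
  rewrite (bigID (fun v : 'I_n => (v < u)%N)) /=; congr (_ + _); apply: eq_bigl => v.
    by case: (v \notin G) => //=; rewrite neq_ltn; case: ltngtP.
  by case: (v \notin G) => //=; rewrite neq_ltn; case: ltngtP.
rewrite S2 big_split /=.
rewrite [X in _ + X](exchange_big_dep (fun v => v \notin G)) /=; last by move=> ? ? _ /andP[].
rewrite -big_split /= big1 // => u uG.
under [X in _ + X]eq_bigl => v do rewrite uG /=.
rewrite -big_split /= big1 // => v /andP[vG vu].
rewrite /T setUCA !mulrA -mulrDl.
rewrite !eps_setU1 //.
by rewrite vu ltnNge (ltnW vu) /= expr0 expr1; ring.
Qed.

Lemma bd_entryE F G :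
  bd_entry k F G = \sum_(v | (v \notin G) && (F == v |: G)) eps v G.
Proof.
rewrite /bd_entry; case: ifP => [/andP[GF /cards1P[w Fw]]|hF].
  apply: eq_bigl => v; rewrite Fw in_set1.
  have FE : F = w |: G by rewrite -(setID F G) (setIidPr GF) Fw setUC.
  have wG : w \notin G by have := set11 w; rewrite -Fw inE => /andP[].
  apply/eqP/andP=> [->|[vG /eqP Fv]]; first by rewrite wG FE.
  have : v \in w |: G by rewrite -FE Fv setU11.
  by rewrite !inE (negbTE vG) orbF => /eqP.
rewrite big_pred0 // => v; apply/negP=> /andP[vG /eqP FE]; move: hF.
rewrite FE subsetUr setDUl setDv setU0.
have -> : [set v] :\: G = [set v].
  by apply/setP=> w; rewrite !inE; have [->|] := eqVneq w v; rewrite ?vG ?andbF.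
by rewrite cards1.
Qed.

Lemma bdE z G : bd z G = \sum_F z F * bd_entry k F G.
Proof.
under [RHS]eq_bigr => F _ do rewrite bd_entryE big_distrr /=.
rewrite (exchange_big_dep (fun v => v \notin G)) /=; last by move=> ? ? _ /andP[].
apply: eq_bigr => v vG; rewrite (big_pred1 (v |: G)) 1?mulrC // => F.
by rewrite /= vG.
Qed.

Lemma in_faces K j F : (F \in faces K j) = (F \in K) && (#|F| == j).
Proof. by rewrite inE. Qed.

Lemma chain_bd K j z : down_closed K -> chain K j z -> chain K j.-1 (bd z).
Proof.
move=> dK zK G; apply: contraR => GK; apply/eqP/big1 => v vG.
rewrite (chain0 zK) ?mulr0 //; apply: contra GK.
rewrite !in_faces cardsU1 vG => /andP[vGK /eqP <-].
by rewrite (dK _ _ vGK) ?subsetUr /=.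
Qed.

(** Coordinates identify chains with row vectors, and the boundary matrix with [bd]. *)
Definition chain_row K j (z : {set 'I_n} -> k) : 'rV[k]_#|faces K j| :=
  \row_a z (enum_val a).

Lemma chain_row_inj K j z1 z2 : chain K j z1 -> chain K j z2 ->
  chain_row K j z1 = chain_row K j z2 -> z1 =1 z2.
Proof.
move=> c1 c2 e F; have [FK|FK] := boolP (F \in faces K j).
  by move/rowP/(_ (enum_rank_in FK F)): e; rewrite !mxE enum_rankK_in.
by rewrite (chain0 c1) // (chain0 c2).
Qed.

Lemma chain_row_surj K j (x : 'rV[k]_#|faces K j|) :
  exists2 z, chain K j z & chain_row K j z = x.
Proof.
exists (fun F => \sum_(a | enum_val a == F) x 0 a).
  move=> F; apply: contraR => FK; apply/eqP/big_pred0 => a.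
  by apply: contraNF FK => /eqP <-; apply: enum_valP.
apply/rowP=> a; rewrite mxE (big_pred1 a) // => b.
by rewrite /= (inj_eq enum_val_inj).
Qed.

Lemma chain_row_bd K j z : chain K j z ->
  chain_row K j z *m bdmx k K j = chain_row K j.-1 (bd z).
Proof.
move=> zK; apply/rowP=> b; rewrite !mxE bdE.
rewrite [RHS](bigID (mem (faces K j))) /= [X in _ = _ + X]big1 ?addr0; last first.
  by move=> F FK; rewrite (chain0 zK FK) mul0r.
rewrite [RHS]big_enum_val /=; apply: eq_bigr => a _; by rewrite !mxE.
Qed.

Lemma bdmx_bdmx K j : down_closed K -> bdmx k K j.+1 *m bdmx k K j = 0.
Proof.
move=> dK; apply/row_matrixP=> a; rewrite row0 row_mul rowE -mulmxA.
have [z zK <-] := chain_row_surj (delta_mx 0 a : 'rV[k]_#|faces K j.+1|).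
rewrite mulmxA (chain_row_bd zK) (chain_row_bd (chain_bd dK zK)).
by apply/rowP=> b; rewrite !mxE bd_bd.
Qed.

(** In size 0 the only possible row is that of the empty face, on which [bd_entry] vanishes. *)
Lemma rk_bdE K j : rk_bd k K j = \rank (bdmx k K j).
Proof.
case: j => //=; apply/esym/eqP; rewrite mxrank_eq0; apply/eqP/matrixP=> a b.
rewrite !mxE /bd_entry; have := enum_valP a; rewrite inE => /andP[_ /eqP/cards0_eq ->].
by rewrite set0D cards0 andbF.
Qed.

(** Boundaries are cycles; hence the truncated subtractions in [rhdim] and [betti] are exact. *)
Lemma rk_bd_add K j : down_closed K ->
  (rk_bd k K j + rk_bd k K j.+1 <= #|faces K j|)%N.
Proof.
move=> dK; rewrite !rk_bdE -leq_subRL ?rank_leq_row // -mxrank_ker.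
by apply: mxrankS; apply/sub_kermxP; apply: bdmx_bdmx.
Qed.

(* Indexed by face size, as [rhdim]: reduced homology in dimension [j - 1]. *)
Definition has_homology K j : Prop := exists z, [/\ chain K j z, bd z =1 (fun=> 0) &
  ~ exists2 y, chain K j.+1 y & bd y =1 z].

Lemma rhdim_neq0 K j : down_closed K -> rhdim k K j != 0%N <-> has_homology K j.
Proof.
move=> dK; rewrite /rhdim !rk_bdE -mxrank_ker subn_eq0 -ltnNge; split.
  move=> lt; have /row_subPn[a] : ~~ (kermx (bdmx k K j) <= bdmx k K j.+1)%MS.
    by apply: contraL lt => /mxrankS; rewrite leqNgt.
  have : row a (kermx (bdmx k K j)) *m bdmx k K j = 0.
    by rewrite -row_mul mulmx_ker row0.
  move: (row a _) => x x0 nx; have [z zK xz] := chain_row_surj x.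
  exists z; split=> //.
    apply: (chain_row_inj (chain_bd dK zK)) => [F|]; first by rewrite eqxx.
    by rewrite -chain_row_bd // xz x0; apply/rowP=> b; rewrite !mxE.
  case=> y yK yz; case/negP: nx; apply/submxP; exists (chain_row K j.+1 y).
  by rewrite chain_row_bd //= -xz; apply/rowP=> b; rewrite !mxE yz.
case=> z [zK z0 nz]; apply: rank_ltmx; rewrite /ltmx; apply/andP; split.
  by apply/sub_kermxP; apply: bdmx_bdmx.
apply/negP => sub; apply: nz.
have : (chain_row K j z <= bdmx k K j.+1)%MS.
  apply: submx_trans sub; apply/sub_kermxP; rewrite chain_row_bd //.
  by apply/rowP=> b; rewrite !mxE z0.
case/submxP=> x; have [y yK <-] := chain_row_surj x.
rewrite chain_row_bd // => e; exists y => //.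
by apply: (chain_row_inj (chain_bd dK yK) zK (esym e)).
Qed.

Lemma in_link K H F : (F \in link K H) = [disjoint F & H] && (F :|: H \in K).
Proof.
apply/imsetP/andP=> [[G]|[FH FHK]].
  rewrite inE => /andP[GK HG] ->; split; first by rewrite disjoints_subset subDset setUCr subsetT.
  by rewrite setUC -{1}(setIidPr HG) setID.
exists (F :|: H); first by rewrite inE FHK subsetUr.
by rewrite setDUl setDv setU0 (setDidPl FH).
Qed.

Lemma in_link1 K v F : (F \in link K [set v]) = (v \notin F) && (v |: F \in K).
Proof. by rewrite in_link disjoint_sym disjoints1 setUC. Qed.

Lemma down_closed_link K H : down_closed K -> down_closed (link K H).
Proof.
move=> dK F E; rewrite !in_link => /andP[FH FHK] EF.
by rewrite (disjointWl EF FH) (dK _ _ FHK) // setSU.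
Qed.

Lemma down_closed_induced K W : down_closed K -> down_closed (induced K W).
Proof.
move=> dK F E; rewrite !inE => /andP[FK FW] EF.
by rewrite (dK _ _ FK EF) (subset_trans EF FW).
Qed.

(* From the long exact sequence of the pair (L, L - v), whose relative homology is
   that of the link of v shifted by one. *)
Lemma rhdim_link_vertex L v j : down_closed L ->
  rhdim k (link L [set v]) j != 0%N ->
  (rhdim k (induced L [set~ v]) j != 0%N) || (rhdim k L j.+1 != 0%N).
Proof.
move=> dL; set K := induced L _; set M := link L _.
have dM : down_closed M by apply: down_closed_link.
have dK : down_closed K by apply: down_closed_induced.
move=> /(rhdim_neq0 _ dM)[z [zM z0 nz]].
have inK F : (F \in K) = (v \notin F) && (F \in L).
  by rewrite inE andbC subsetC sub1set inE.
apply: contraT; rewrite negb_or => /andP[/negP nK /negP nL].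
(* [z] is also a cycle of [L] without [v]. If it is no boundary there, the first alternative holds;
   otherwise it bounds some [y], which closes up the cone below. *)
case: nK; apply/rhdim_neq0 => //; exists z; split=> //.
  move=> F /zM; rewrite !in_faces inK in_link1 => /andP[/andP[-> FL] ->].
  by rewrite (dL _ _ FL) // subsetUr.
case=> y yK yz; case: nL; apply/rhdim_neq0 => //.
have zv G : v \in G -> z G = 0.
  by move=> vG; apply: (chain0 zM); rewrite in_faces in_link1 vG.
have yv G : v \in G -> y G = 0.
  by move=> vG; apply: (chain0 yK); rewrite in_faces inK vG.
have vF F : v \in F -> v |: (F :\ v) = F by move=> vF; rewrite setD1K.
pose cz F := if v \in F then eps v (F :\ v) * z (F :\ v) else 0.
(* [cz] is the cone over [z] with apex [v], so [cz - y] is a cycle whose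
   [v]-component is [z]. *)
pose w F := cz F - y F.
have bdD f g G : bd (fun F => f F - g F) G = bd f G - bd g G.
  by rewrite /bd -sumrB; apply: eq_bigr => u _; rewrite mulrBr.
(* If [x] has [v]-component [x1], then [bd x] has [v]-component minus [bd x1]. *)
have bdv (x x1 : {set 'I_n} -> k) G :
    (forall H, v \notin H -> x (v |: H) = eps v H * x1 H) -> (forall H, v \in H -> x1 H = 0) ->
    v \notin G -> bd x (v |: G) = - (eps v G * bd x1 G).
  move=> xE x1v vG; rewrite /bd (bigD1 v vG) /= x1v ?setU11 // mulr0 add0r.
  rewrite big_distrr -sumrN /=.
  apply: eq_big => [u|u]; first by rewrite !inE negb_or andbC.
  rewrite !inE negb_or => /andP[uv uG].
  rewrite setUCA xE ?inE ?negb_or 1?eq_sym ?uv //.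
  by rewrite !mulrA eps_swap // mulNr.
have bdcz : bd cz =1 z.
  move=> G; have [vG|vG] := boolP (v \in G).
    rewrite -(vF _ vG) (bdv cz z) ?setD11 //; last first.
      by move=> H vH; rewrite /cz setU11 setU1K.
    by rewrite z0 mulr0 oppr0 zv ?setU11.
  rewrite /bd (bigD1 v) //= /cz setU11 setU1K // mulrA eps_sqr mul1r big1 ?addr0 //.
  move=> u /andP[_ uv]; rewrite !inE eq_sym (negbTE uv) (negbTE vG) /= mulr0 //.
exists w; split.
- move=> F; rewrite /w /cz; case: ifP => [vF1|vF1].
    rewrite (yv _ vF1) subr0 mulf_eq0 negb_or => /andP[_ /zM].
    rewrite !in_faces in_link1 (vF _ vF1) => /andP[/andP[_ ->] /eqP <-].
    by rewrite (cardsD1 v F) vF1 add1n eqxx.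
  rewrite sub0r oppr_eq0 => /yK; rewrite !in_faces inK => /andP[/andP[_ ->] ->] //.
- by move=> G; rewrite bdD bdcz yz subrr.
case=> x xL xw; apply: nz.
(* If [w] were the boundary of [x], the negated [v]-component of [x] would be a chain of the link
   bounding [z]. *)
pose x1 H := if v \in H then 0 else eps v H * x (v |: H).
have x1v H : v \in H -> x1 H = 0 by rewrite /x1 => ->.
exists (fun F => - x1 F).
  move=> F; rewrite oppr_eq0 /x1; case: ifP => [|vF1]; first by rewrite eqxx.
  rewrite mulf_eq0 negb_or => /andP[_ /xL]; rewrite !in_faces in_link1 vF1 /=.
  by rewrite cardsU1 vF1 /= add1n eqSS.
move=> G; have -> : bd (fun F => - x1 F) G = - bd x1 G.
  by rewrite /bd -sumrN; apply: eq_bigr => u _; rewrite mulrN.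
have [vG|vG] := boolP (v \in G).
  rewrite zv // /bd big1 ?oppr0 // => u uG.
  by rewrite x1v ?mulr0 // inE vG orbT.
have := xw (v |: G); rewrite (bdv x x1) //; last first.
  by move=> H vH; rewrite /x1 (negbTE vH) mulrA eps_sqr mul1r.
rewrite /w yv ?setU11 // subr0 /cz setU11 setU1K // -mulrN.
by move/(congr1 (fun t => eps v G * t)); rewrite !mulrA eps_sqr !mul1r.
Qed.

(** Vertices of [F] are peeled off one at a time. Each is either discarded, with [q] unchanged, or
    added to [W] while [q] grows by one, so [#|W| - q] is invariant. *)
Lemma rhdim_link_induced K F W q : down_closed K -> [disjoint F & W] ->
  rhdim k (induced (link K F) W) q != 0%N ->
  exists W' q', [/\ W' \subset F :|: W, rhdim k (induced K W') q' != 0%N,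
    (#|W| <= #|W'|)%N & (#|W'| + q = #|W| + q')%N].
Proof.
have [s] := ubnP #|F|; elim: s => // s IH in K F * => Fs dK FW h.
have [F0|/set0Pn[v vF]] := eqVneq F set0.
  exists W, q; rewrite F0 set0U; split=> //.
  suff <- : link K F = K by [].
  by apply/setP => G; rewrite F0 in_link setU0 disjoint_sym disjoints_subset sub0set.
have Fv : (#|F :\ v| < s)%N by move: Fs; rewrite (cardsD1 v) vF add1n ltnS.
have lE : link K F = link (link K [set v]) (F :\ v).
  apply/setP=> G; rewrite in_link [RHS]in_link in_link1.
  rewrite setUCA setD1K // inE setD11 orbF andbA; congr (_ && _).
  by rewrite !(disjoint_sym G) -{1}(setD1K vF) !disjoints_subset subUset sub1set inE andbC.
have vW : v \notin W by have := disjointFr FW vF => ->.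
have [|//||W' [q' [W'F h' ? ?]]] := IH (link K [set v]) (F :\ v) _ (down_closed_link dK).
- by [].
- exact: disjointWl (subsetDl _ _) FW.
- by rewrite -lE.
have vW' : v \notin W'.
  by apply: contra vW => /(subsetP W'F); rewrite !inE eqxx.
have W'FW : W' \subset F :|: W.
  exact: subset_trans W'F (setSU _ (subsetDl _ _)).
(* The single-vertex lemma is applied to the subcomplex induced on [v |: W']; [l1] and [l2] identify
   its link at [v] and its deletion of [v]. *)
have l1 : link (induced K (v |: W')) [set v] = induced (link K [set v]) W'.
  apply/setP=> G; rewrite in_link1 in_set [in RHS]in_set in_link1 -andbA.
  have [//|vG] /= := boolP (v \in G); congr (_ && _).
  by rewrite subUset sub1set setU11 -subDset (setDidPl _) // disjoint_sym disjoints1.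
have l2 : induced (induced K (v |: W')) [set~ v] = induced K W'.
  apply/setP=> G; rewrite !in_set -andbA; congr (_ && _).
  rewrite -subDset subsetC sub1set inE.
  have [vG|vG] := boolP (v \in G).
    by rewrite andbF; apply/esym/negbTE; apply: contra vW' => /subsetP; apply.
  by rewrite andbT (setDidPl _) // disjoint_sym disjoints1.
have := @rhdim_link_vertex (induced K (v |: W')) v q' (down_closed_induced dK).
rewrite l1 l2 => /(_ h')/orP[h2|h2]; first by exists W', q'.
exists (v |: W'), q'.+1; split=> //.
- by rewrite subUset sub1set inE vF.
- by rewrite cardsU1 vW' ltnW.
- by rewrite cardsU1 vW' /= add1n addSn addnS; congr _.+1.
Qed.

Lemma Mmax_ge K F W q : down_closed K -> [disjoint F & W] -> (q <= #|W|)%N ->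
  rhdim k (induced (link K F) W) q != 0%N -> (#|W| <= Mmax k K (#|W| - q))%N.
Proof.
move=> dK FW qW h; have [W' [q' [_ h' WW' e]]] := rhdim_link_induced dK FW h.
apply: leq_trans WW' _; rewrite /Mmax.
have e1 : (#|W| - q = #|W'| - q')%N by lia.
apply: (@leq_bigmax_cond _ _ (fun W : {set 'I_n} => #|W|)).
by rewrite e1 subKn ?h' ?leq_subr //; lia.
Qed.

(** With [r] the boundary ranks, the alternating sum telescopes. *)
Lemma euler_poincare_aux (f r : nat -> nat) D :
  (forall j, r j + r j.+1 <= f j)%N -> r 0%N = 0%N ->
  \sum_(j < D) (-1) ^+ j * (f j - r j - r j.+1)%:Z =
  \sum_(j < D) (-1) ^+ j * (f j)%:Z + (-1) ^+ D * (r D)%:Z.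
Proof.
move=> fr r0; elim: D => [|D IH]; first by rewrite !big_ord0 r0 mulr0.
rewrite !big_ord_recr /= IH exprS mulN1r.
have -> : (f D - r D - r D.+1)%:Z = (f D)%:Z - (r D)%:Z - (r D.+1)%:Z.
  by have := fr D; lia.
by ring.
Qed.

Lemma faces_gt K d j : (forall F, F \in K -> (#|F| <= d)%N) -> (d < j)%N ->
  faces K j = set0.
Proof.
move=> Kd dj; apply/setP=> F; rewrite !inE; apply/negbTE/negP=> /andP[/Kd Fd /eqP Fj].
by move: dj; rewrite -Fj ltnNge Fd.
Qed.

Lemma rk_bd_gt K d j : (forall F, F \in K -> (#|F| <= d)%N) -> (d < j)%N ->
  rk_bd k K j = 0%N.
Proof.
move=> Kd dj; apply/eqP; rewrite rk_bdE -leqn0 (leq_trans (rank_leq_row _)) //.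
by rewrite (faces_gt Kd dj) cards0.
Qed.

Lemma euler_poincare_reduced K d : down_closed K -> (forall F, F \in K -> (#|F| <= d)%N) ->
  \sum_(j < d.+1) (-1) ^+ j * (rhdim k K j)%:Z =
  \sum_(j < d.+1) (-1) ^+ j * #|faces K j|%:Z :> int.
Proof.
move=> dK Kd; rewrite /rhdim.
rewrite (euler_poincare_aux _ (f := fun j => #|faces K j|) (r := fun j => rk_bd k K j)) //.
  by rewrite (rk_bd_gt Kd) // mulr0 addr0.
by move=> j; apply: rk_bd_add.
Qed.

Lemma euler_charE K d : down_closed K -> (forall F, F \in K -> (#|F| <= d)%N) ->
  euler_char k K d = \sum_(j < d) (-1) ^+ j * #|faces K j.+1|%:Z.
Proof.
move=> dK Kd; rewrite /euler_char.
(* Non-reduced homology drops the augmentation, so the rank out of the vertices is set to 0. *)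
pose r j := if j is 0 then 0%N else rk_bd k K j.+1.
have -> : \sum_(i < d) (-1) ^+ i * (betti k K i)%:Z =
    \sum_(i < d) (-1) ^+ i * (#|faces K i.+1| - r i - r i.+1)%:Z.
  by apply: eq_bigr => i _; rewrite /betti /r; case: (nat_of_ord i).
rewrite (euler_poincare_aux _ (f := fun j => #|faces K j.+1|)) //.
  case: d Kd => [|d] Kd; first by rewrite /r mulr0 addr0.
  by rewrite /r (rk_bd_gt Kd) // mulr0 addr0.
move=> [|j]; last by rewrite /r rk_bd_add.
by rewrite /r add0n (leq_trans _ (rk_bd_add 1 dK)) // leq_addl.
Qed.
End Chains.

Lemma subset_of_card (T : finType) (A B : {set T}) s :
  A \subset B -> (#|A| <= s <= #|B|)%N ->
  exists E : {set T}, [/\ A \subset E, E \subset B & #|E| = s].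
Proof.
move=> AB /andP[As sB].
have : (0 < #|[set E : {set T} | E \subset B :\: A & #|E| == s - #|A|]|)%N.
  by rewrite cards_draws bin_gt0 cardsDS // leq_sub2r.
case/card_gt0P=> E; rewrite inE subsetD => /andP[/andP[EB EA] /eqP Es].
exists (A :|: E); split; rewrite ?subsetUl ?subUset ?AB //.
by rewrite cardsU setIC disjoint_setI0 // cards0 subn0 Es subnKC.
Qed.

(** * Face numbers of homology manifolds *)

Section FaceCounts.
Variable n : nat.
Implicit Types (F G H E W : {set 'I_n}) (K : {set {set 'I_n}}).

Definition cofaces K F i := [set H in faces K i | F \subset H].

(** Double counting of inclusions; down-closure makes every [j]-subset of a face a face. *)
Lemma sum_cofaces K i j : down_closed K ->
  (\sum_(F in faces K j) #|cofaces K F i| = 'C(i, j) * #|faces K i|)%N.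
Proof.
move=> dK; under eq_bigr => F _ do rewrite -sum1_card.
rewrite (exchange_big_dep (mem (faces K i))) /=; last by move=> F H _; rewrite inE => /andP[].
rewrite mulnC -sum_nat_const; apply: eq_bigr => H HK.
move: (HK); rewrite inE => /andP[HK' /eqP Hi].
rewrite sum1_card -Hi -cards_draws -sum1_card -[RHS]sum1_card.
apply: eq_bigl => F; rewrite unfold_in !inE HK' eqxx /= andbC.
by case: (boolP (F \subset H)) => //= FH; rewrite (dK _ _ HK' FH).
Qed.

Lemma card_faces_link K F j : #|faces (link K F) j| = #|cofaces K F (j + #|F|)|.
Proof.
rewrite -(card_in_imset (f := fun H => H :\: F) (D := mem (cofaces K F _))).
  apply: eq_card => E; rewrite !inE in_link; apply/andP/imsetP.
    case=> /andP[EF EK] /eqP Ej; exists (E :|: F).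
      rewrite !inE EK subsetUr andbT /=.
      by rewrite cardsU disjoint_setI0 // cards0 subn0 Ej.
    by rewrite setDUl setDv setU0 (setDidPl EF).
  case=> H; rewrite !inE => /andP[/andP[HK /eqP Hj] FH] ->.
  rewrite setDE disjoints_subset subsetIr -setDE setUC -{1}(setIidPr FH) setID HK.
  by rewrite cardsDS // Hj addnK.
move=> H1 H2; rewrite !inE => /andP[_ F1] /andP[_ F2] e.
by rewrite -(setID H1 F) -(setID H2 F) (setIidPr F1) (setIidPr F2) e.
Qed.

End FaceCounts.

Section Manifold.
Variables (k : fieldType) (n d : nat) (G : {set {set 'I_n}}).
Hypothesis hG : homology_manifold k d G.
Implicit Types (F H E W : {set 'I_n}).

Let dG : down_closed G. Proof. by case: hG => -[]. Qed.
Let Gd F : F \in G -> (#|F| <= d)%N. Proof. by case: hG => _ _ + _; apply. Qed.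

Lemma card_link F H : F \in G -> H \in link G F -> (#|H| <= d - #|F|)%N.
Proof.
move=> FG; rewrite in_link => /andP[HF /Gd].
by rewrite cardsU disjoint_setI0 // cards0 subn0; lia.
Qed.

(** The link of [F] has the homology of a sphere, so its reduced Euler characteristic is a sign; the
    shift of sizes by [#|F|] turns it into [(-1) ^+ d]. *)
Lemma manifold_local_euler F : F \in G -> F != set0 ->
  \sum_(i < d.+1) (-1) ^+ i * #|cofaces G F i|%:Z = (-1) ^+ d :> int.
Proof.
move=> FG F0; have Fd := Gd FG.
have [_ _ _ /(_ F FG F0)[top low]] := hG.
have := euler_poincare_reduced k (down_closed_link (H := F) dG) (fun H => @card_link F H FG).
rewrite big_ord_recr /= top mulr1 big1 ?add0r; last by move=> i _; rewrite low // mulr0.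
move=> e; rewrite -(big_mkord xpredT (fun i => (-1) ^+ i * #|cofaces G F i|%:Z)).
rewrite (@big_cat_nat _ _ _ #|F|) ?leqW // [X in X + _ = _]big1_seq ?add0r; last first.
  move=> i; rewrite mem_index_iota => /andP[_ /andP[_ iF]].
  rewrite (_ : cofaces G F i = set0) ?cards0 ?mulr0 //.
  apply/setP=> H; rewrite !inE; apply/negbTE/negP => /andP[/andP[_ /eqP Hi]] /subset_leq_card.
  by rewrite Hi leqNgt iF.
rewrite -{1}(add0n #|F|) big_addn subSn // big_mkord.
under eq_bigr => i _ do rewrite exprD mulrAC -card_faces_link.
by rewrite -big_distrl /= -e -exprD subnK.
Qed.

(** The local relation is summed over the faces with [j] vertices, which are nonempty as the
    manifold condition requires. *)
Lemma dehn_sommerville j : (0 < j)%N ->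
  \sum_(i < d.+1) (-1) ^+ i * ('C(i, j) * #|faces G i|)%:Z = (-1) ^+ d * #|faces G j|%:Z :> int.
Proof.
move=> j0; under eq_bigr => i _.
  rewrite -(sum_cofaces _ _ dG) -natz natr_sum big_distrr /=.
  over.
rewrite exchange_big /= -natz mulr_natr -sumr_const; apply: eq_bigr => F.
rewrite inE => /andP[FG /eqP Fj].
rewrite -(manifold_local_euler FG) -?card_gt0 ?Fj //.
by apply: eq_bigr => i _; rewrite natz.
Qed.

(** This replaces the relation for [j = 0], since the whole complex need not be a homology
    sphere. *)
Lemma euler_char_faces :
  \sum_(i < d.+1) (-1) ^+ i * #|faces G i|%:Z = 1 - euler_char k G d :> int.
Proof.
have G0 : set0 \in G.
  by have [_ [F FG _] _ _] := hG; apply: dG FG (sub0set F).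
rewrite (euler_charE k dG Gd) big_ord_recl expr0 mul1r; congr (_ + _).
  rewrite (_ : faces G 0 = [set set0]) ?cards1 //; apply/setP=> F.
  by rewrite !inE cards_eq0 andbC; case: eqP => //= ->.
by rewrite -sumrN; apply: eq_bigr => i _; rewrite /= exprS mulN1r mulNr.
Qed.

(** The link of [F] has homology in size [d - #|F|], hence a face of that size. *)
Lemma manifold_pure F : F \in G -> exists H, [/\ H \in G, F \subset H & #|H| = d].
Proof.
move=> FG; have [F0|F0] := eqVneq F set0.
  by have [_ [H HG Hd] _ _] := hG; exists H; rewrite F0 sub0set.
have [_ _ _ /(_ F FG F0)[top _]] := hG.
have : (0 < #|faces (link G F) (d - #|F|)|)%N by rewrite lt0n; apply: contra_eq_neq top => h; rewrite /rhdim h.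
rewrite card_faces_link subnK ?Gd // => /card_gt0P[H].
by rewrite !inE => /andP[/andP[HG /eqP Hd] FH]; exists H.
Qed.

(** By purity every face with [i] vertices lies in one with [m], which has only 2^m subsets. *)
Lemma faces_le i m : (i <= m <= d)%N -> (#|faces G i| <= 2 ^ m * #|faces G m|)%N.
Proof.
case/andP=> im md.
have sub : faces G i \subset \bigcup_(E in faces G m) powerset E.
  apply/subsetP=> F; rewrite inE => /andP[FG /eqP Fi].
  have [H [HG FH Hd]] := manifold_pure FG.
  have [|E [FE EH Em]] := subset_of_card FH (s := m); first by rewrite Fi im Hd.
  apply/bigcupP; exists E; last by rewrite inE.
  by rewrite inE Em eqxx (dG HG EH).
apply: leq_trans (subset_leq_card sub) _.
rewrite mulnC -sum_nat_const.
have le_big (P : {set {set 'I_n}}) (A : {set 'I_n} -> {set {set 'I_n}}) :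
    (#|\bigcup_(E in P) A E| <= \sum_(E in P) #|A E|)%N.
  elim/big_ind2: _ => [|x1 x2 y1 y2 h1 h2|//]; first by rewrite cards0.
  by rewrite (leq_trans (leq_card_setU _ _)) ?leq_add.
apply: leq_trans (le_big _ _) _; apply: leq_sum => E.
by rewrite inE card_powerset => /andP[_ /eqP ->].
Qed.

(** * Links with few vertices and lower bounds for M_i *)

Definition link_vertices F := [set v | (v \notin F) && (v |: F \in G)].

Lemma card_link_vertices F : (#|link_vertices F| <= #|cofaces G F #|F|.+1|)%N.
Proof.
rewrite -(card_in_imset (f := fun v => v |: F)).
  apply/subset_leq_card/subsetP=> _ /imsetP[v + ->].
  by rewrite !inE => /andP[vF ->]; rewrite cardsU1 vF subsetUr add1n eqxx.
move=> u v; rewrite !inE => /andP[uF _] /andP[vF _] /setP/(_ u).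
by rewrite !inE eqxx /= (negbTE uF) orbF => /esym/eqP.
Qed.

(** Averaging: if every link had more than [B] vertices, double counting would contradict the
    hypothesis. *)
Lemma exists_small_link m B : (#|faces G m| > 0)%N ->
  (m.+1 * #|faces G m.+1| <= B * #|faces G m|)%N ->
  exists2 F, F \in faces G m & (#|link_vertices F| <= B)%N.
Proof.
move=> m0 le.
have [/exists_inP[F FG h]|/exists_inPn no] :=
  boolP [exists F in faces G m, (#|link_vertices F| <= B)%N]; first by exists F.
have : (B.+1 * #|faces G m| <= m.+1 * #|faces G m.+1|)%N.
  rewrite -[in X in (_ <= X * _)%N](binSn m) -(sum_cofaces _ _ dG) mulnC -sum_nat_const.
  apply: leq_sum => F FG; have := no F FG; rewrite -ltnNge => h.
  by apply: leq_trans h _; move: FG (card_link_vertices F); rewrite inE => /andP[_ /eqP ->].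
by move=> h; have := leq_trans h le; rewrite leq_pmul2r // ltnn.
Qed.

(** Elements of [W] outside the link enlarge [#|W|] but leave the induced complex equal to the whole
    link, which has top homology. *)
Lemma Mmax_ge_link F W : F \in G -> F != set0 -> [disjoint F & W] ->
  link_vertices F \subset W -> (d - #|F| <= #|W|)%N ->
  (#|W| <= Mmax k G (#|W| - (d - #|F|)))%N.
Proof.
move=> FG F0 FW LW dF; apply: (Mmax_ge dG FW dF).
have -> : induced (link G F) W = link G F.
  apply/setP=> H; rewrite inE andb_idr // in_link => /andP[HF HG].
  apply: subset_trans LW; apply/subsetP=> v vH; rewrite inE (disjointFr HF vH) /=.
  by apply: dG HG _; rewrite subUset sub1set inE vH subsetUr.
by have [_ _ _ /(_ F FG F0)[-> _]] := hG.
Qed.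

(** The link of a facet [F] consists of the empty face, with homology in size 0, so any [W] of size
    [i] avoiding [F] works. *)
Lemma Mmax_ge_index i : (0 < d)%N -> (i <= n - d)%N -> (i <= Mmax k G i)%N.
Proof.
move=> d0 i_nd; have [_ [F FG Fd] _ _] := hG.
have [|W [_ WF Wi]] := @subset_of_card _ set0 (~: F) i (sub0set _).
  by rewrite cards0 cardsCs setCK card_ord Fd.
have := @Mmax_ge_link F W FG; rewrite Fd subnn subn0 Wi; apply=> //.
- by rewrite -card_gt0 Fd.
- by rewrite disjoint_sym disjoints_subset.
apply/subsetP=> v; rewrite inE => /andP[vF /Gd].
by rewrite cardsU1 vF Fd ltnn.
Qed.

Lemma Mmax_ge_shift F i : F \in G -> F != set0 -> (#|link_vertices F| <= i <= n - d)%N ->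
  (i + (d - #|F|) <= Mmax k G i)%N.
Proof.
move=> FG F0 /andP[Li i_nd]; have Fd := Gd FG.
have nF : #|~: F| = (n - #|F|)%N by rewrite cardsCs setCK card_ord.
have nd : (d <= n)%N.
  by have [_ [H _ <-] _ _] := hG; rewrite -[X in (_ <= X)%N]card_ord max_card.
have LF : link_vertices F \subset ~: F.
  by apply/subsetP=> v; rewrite !inE => /andP[].
(* The bound [i <= n - d] is exactly what lets [W] fit outside [F]. *)
have [|W [LW WF Wi]] := subset_of_card LF (s := (i + (d - #|F|))%N).
  by rewrite nF; lia.
have := @Mmax_ge_link F W FG F0; rewrite Wi addnK; apply=> //; last exact: leq_addl.
by rewrite disjoint_sym disjoints_subset.
Qed.

End Manifold.

(** * Polynomials with g(-1-x) = -g(x) *)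

Lemma coef_expX1 i j : ((1 + 'X) ^+ i : {poly rat})`_j = 'C(i, j)%:R.
Proof.
rewrite exprDn coef_sum.
under eq_bigr => l _ do rewrite expr1n mul1r coefMn coefXn.
have [ji|ij] := ltnP j i.+1; last first.
  rewrite bin_small // big1 // => l _; case: eqP => [jl|]; last by rewrite mul0rn.
  by move: ij; rewrite jl leqNgt ltn_ord.
rewrite (bigD1 (Ordinal ji)) //= eqxx big1 ?addr0 // => l lj.
by case: eqP => [jl|]; [case/eqP: lj; apply: val_inj | rewrite mul0rn].
Qed.

Lemma coef_expNX1 i j :
  ((- (1 + 'X)) ^+ i : {poly rat})`_j = (-1) ^+ i * 'C(i, j)%:R.
Proof.
have -> : - (1 + 'X) = (-1)%:P * (1 + 'X) :> {poly rat} by rewrite polyCN mulN1r.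
rewrite exprMn -rmorphXn /= coefCM coef_expX1 //.
Qed.

(* If [p(-1-x) = -p(x)] and [x^(m+1)] divides [p], so does [(1+x)^(m+1)]. *)
Lemma antisym_poly_eq0 m (p : {poly rat}) : (size p <= m.+1.*2)%N ->
  p \Po (- (1 + 'X)) = - p -> (forall i, (i < m.+1)%N -> p`_i = 0) -> p = 0.
Proof.
move=> sp pS p0; apply/eqP; apply: contraT => pn0.
have r2 : size (- (1 + 'X) : {poly rat}) = 2%N by rewrite size_polyN addrC size_XaddC.
have rn0 : - (1 + 'X) != 0 :> {poly rat} by rewrite -size_poly_gt0 r2.
have dX : 'X^(m.+1) %| p.
  rewrite -(poly_take_drop m.+1 p) (_ : take_poly _ p = 0) ?add0r ?dvdp_mull //.
  by apply/polyP=> i; rewrite coef_take_poly coef0; case: ifP => // /p0.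
have dr : (- (1 + 'X)) ^+ m.+1 %| p.
  have /dvdpP[q pq] := dX.
  by rewrite -dvdpNr -pS pq comp_polyM comp_Xn_poly dvdp_mull.
have cop : coprimep ('X^(m.+1) : {poly rat}) ((- (1 + 'X)) ^+ m.+1).
  rewrite coprimep_expl ?coprimep_expr // coprimep_sym.
  have := coprimep_XsubC (- (1 + 'X) : {poly rat}) 0; rewrite subr0 => ->.
  by rewrite rootE !hornerE.
(* This divisor has degree 2m+2, while [p] has degree at most 2m+1. *)
have : 'X^(m.+1) * (- (1 + 'X)) ^+ m.+1 %| p by rewrite Gauss_dvdp // dX dr.
move/(dvdp_leq pn0)/leq_trans/(_ sp).
rewrite size_mul ?expf_neq0 ?polyX_eq0 // size_polyXn -addnn.
have : (size ((- (1 + 'X) : {poly rat}) ^+ m.+1)).-1 = m.+1 by rewrite size_exp r2 mul1n.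
by case: (size _) => [|s] //= ->; rewrite addnS ltnn.
Qed.

(** The hypothesis on [g] compares coefficients in g(-1-x) = -g(x). Such a [g] is determined
    linearly by its first m+1 entries, hence bounded by them with a constant depending on [m]
    alone. *)
Lemma antisym_coef_bound m : exists C : nat, forall g : nat -> rat,
  (forall j, (j < m.+1.*2)%N ->
     \sum_(i < m.+1.*2) (-1) ^+ i * ('C(i, j)%:R * g i) = - g j) ->
  forall i, (i < m.+1.*2)%N -> `|g i| <= C%:R * \sum_(j < m.+1) `|g j|.
Proof.
set N := m.+1.*2.
pose A : 'M[rat]_N := (\matrix_(i, j) ((-1) ^+ i * 'C(i, j)%:R)) + 1%:M.
pose T : 'M[rat]_N := pid_mx m.+1.
have TE (v : 'rV[rat]_N) j : (v *m T) 0 j = v 0 j *+ (j < m.+1)%N.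
  rewrite !mxE (bigD1 j) //= mxE eqxx /= big1 ?addr0 ?mulr_natr // => i ij.
  by rewrite mxE (inj_eq val_inj) (negbTE ij) mulr0.
have AE (v : 'rV[rat]_N) j : (v *m A) 0 j =
    (\sum_(i < N) (-1) ^+ i * ('C(i, j)%:R * v 0 i)) + v 0 j.
  rewrite mulmxDr mulmx1 !mxE; congr (_ + _); apply: eq_bigr => i _.
  by rewrite mxE mulrC mulrA.
(* [A] vanishes on antisymmetric vectors and [T] keeps the first m+1 entries, so a common kernel
   vector gives a polynomial that [antisym_poly_eq0] shows to be zero. *)
have free : row_free (row_mx A T).
  apply: inj_row_free => v; rewrite mul_mx_row => /eqP.
  rewrite row_mx_eq0 => /andP[/eqP vA /eqP vT].
  pose p : {poly rat} := \sum_(i < N) v 0 i *: 'X^i.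
  have pE (j : 'I_N) : p`_j = v 0 j.
    rewrite coef_sum (bigD1 j) //= coefZ coefXn eqxx mulr1 big1 ?addr0 // => i ij.
    by rewrite coefZ coefXn eq_sym (inj_eq val_inj) (negbTE ij) mulr0.
  have szp : (size p <= N)%N.
    apply: (leq_trans (size_sum _ _ _)); apply/bigmax_leqP => i _.
    by rewrite (leq_trans (size_scale_leq _ _)) // size_polyXn.
  have p0 : p = 0.
    apply: (antisym_poly_eq0 szp) => [|i im]; last first.
      have iN : (i < N)%N by rewrite /N -addnn; lia.
      have := TE v (Ordinal iN); rewrite vT mxE /= im mulr1n => /esym.
      by rewrite -pE.
    have cE j : (p \Po (- (1 + 'X)))`_j = \sum_(i < N) (-1) ^+ i * ('C(i, j)%:R * v 0 i).
      rewrite raddf_sum /= coef_sum; apply: eq_bigr => i _.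
      rewrite linearZ /= comp_Xn_poly coefZ coef_expNX1; ring.
    apply/polyP=> j; rewrite cE coefN; have [jN|jN] := ltnP j N.
      have := AE v (Ordinal jN); rewrite vA mxE -(pE (Ordinal jN)) /=.
      by move/esym/eqP; rewrite addr_eq0 => /eqP.
    rewrite (nth_default 0 (leq_trans szp jN)) oppr0 big1 // => i _.
    by rewrite bin_small ?mul0r ?mulr0 // (leq_trans _ jN).
  by apply/rowP=> j; rewrite -pE p0 coef0 mxE.
set P := pinvmx (row_mx A T).
(* As [v *m A] will vanish, the lower block [Q] of a right inverse recovers [v] from [v *m T]; [C]
   exceeds the sum of the absolute values of its entries. *)
pose Q := dsubmx P.
pose C := Num.bound (\sum_(i < N) \sum_(j < N) `|Q j i|).
exists C => g gS i iN.
pose v : 'rV[rat]_N := \row_i g i.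
have vQ : v = v *m T *m Q.
  rewrite -[LHS]mulmx1 -(mulmxVp free) -/P mulmxA mul_mx_row.
  have -> : v *m A = 0.
    apply/rowP=> j; rewrite AE !mxE -[g j]opprK -(gS j) //.
    by apply/eqP; rewrite subr_eq0; apply/eqP/eq_bigr => l _; rewrite mxE.
  by rewrite -[P]vsubmxK mul_row_col mul0mx add0r.
have S0 : 0 <= \sum_(j < m.+1) `|g j| by apply: sumr_ge0.
have -> : g i = \sum_j (v *m T) 0 j * Q j (Ordinal iN).
  by move/rowP/(_ (Ordinal iN)): vQ; rewrite mxE /= => ->; rewrite mxE.
apply: le_trans (ler_norm_sum _ _ _) _.
apply: (@le_trans _ _ (\sum_j `|Q j (Ordinal iN)| * \sum_(j < m.+1) `|g j|)).
  apply: ler_sum => j _; rewrite normrM mulrC ler_wpM2l // TE mxE.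
  case: ltnP => jm; last by rewrite mulr0n normr0.
  by rewrite (bigD1 (Ordinal jm)) //= mulr1n lerDl sumr_ge0.
rewrite -mulr_suml ler_wpM2r //.
apply: (@le_trans _ _ (\sum_(i < N) \sum_(j < N) `|Q j i|)).
  rewrite [leRHS](bigD1 (Ordinal iN)) //= lerDl; apply: sumr_ge0 => l _; exact: sumr_ge0.
by rewrite ltW // archi_boundP //; apply: sumr_ge0 => l _; apply: sumr_ge0.
Qed.

Lemma manifold_faces_bound m : exists C : nat, forall (k : fieldType) n (G : {set {set 'I_n}}),
  homology_manifold k m.*2.+1 G -> forall i, (0 < i <= m.*2.+1)%N ->
  (#|faces G i| <= C * (`|euler_char k G m.*2.+1| + m * (2 ^ m * #|faces G m|)))%N.
Proof.
have [C hC] := antisym_coef_bound m; exists C => k n G hG i /andP[i0 id].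
set d := m.*2.+1 in hG id *; set chi := euler_char k G d.
pose f j : rat := #|faces G j|%:R.
(* The relation for [j = 0] reads g_0 - chi = -g_0, which forces this constant term; for positive
   [j] it meets a zero binomial coefficient. *)
pose g j : rat := if j is 0 then chi%:~R / 2 else f j.
have fr j : \sum_(i < d.+1) (-1) ^+ i * ('C(i, j)%:R * f i) =
    (\sum_(i < d.+1) (-1) ^+ i * ('C(i, j) * #|faces G i|)%:Z)%:~R.
  rewrite rmorph_sum /=; apply: eq_bigr => l _.
  by rewrite rmorphM rmorphXn /= rmorphN1 -natrM -pmulrn.
have f0 : f 0%N = 1.
  have [[dG _] [F FG _] _ _] := hG.
  rewrite /f (_ : faces G 0 = [set set0]) ?cards1 //; apply/setP=> E.
  by rewrite !inE cards_eq0 andbC; case: eqP => //= ->; rewrite (dG _ _ FG) ?sub0set.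
have hS j : (j < m.+1.*2)%N ->
    \sum_(i < m.+1.*2) (-1) ^+ i * ('C(i, j)%:R * g i) = - g j.
  move=> _; rewrite doubleS -/d; case: j => [|j].
    have := fr 0%N; rewrite [X in _ = X%:~R](_ : _ = 1 - chi); last first.
      by rewrite -(euler_char_faces hG); apply: eq_bigr => l _; rewrite bin0 mul1n.
    rewrite !big_ord_recl /= bin0 expr0 f0 /g rmorphB /=.
    by move/(canRL (addKr _)) ->; field.
  have := fr j.+1; rewrite (dehn_sommerville hG (ltn0Sn j)) !big_ord_recl /=.
  rewrite bin0n /= !mul0r !mulr0 !add0r => ->.
  by rewrite rmorphM rmorphXn /= rmorphN1 -pmulrn -signr_odd /= odd_double mulN1r.
have := hC g hS i; rewrite doubleS ltnS => /(_ id).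
have -> : `|g i| = f i by case: (i) i0 => // l _; rewrite /g ger0_norm // ler0n.
move=> le; rewrite -(ler_nat rat) natrM; apply: le_trans le _.
rewrite ler_wpM2l ?ler0n // big_ord_recl natrD lerD //=.
  rewrite normrM normfV [`|2|]ger0_norm // ler_pdivrMr //.
  by rewrite -intr_norm -abszE -pmulrn ler_peMr ?ler0n // ler1n.
rewrite -[X in X%:R](_ : (\sum_(i < m) (2 ^ m * #|faces G m|) = _)%N); last first.
  by rewrite sum_nat_const card_ord.
rewrite natr_sum ler_sum // => l _; rewrite /g /= ger0_norm ?ler0n // ler_nat.
apply: (faces_le hG); have := ltn_ord l; rewrite /bump /d; lia.
Qed.

(** * Growth estimates *)

Lemma ffact_le_exp n m : (n ^_ m <= n ^ m)%N.
Proof.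
elim: m => [|m IH]; first by rewrite ffactn0 expn0.
by rewrite ffactnSr expnSr leq_mul ?leq_subr.
Qed.

Lemma card_faces_le n (K : {set {set 'I_n}}) m : (#|faces K m| <= n ^ m)%N.
Proof.
apply: (@leq_trans 'C(n, m)); last first.
  by rewrite (leq_trans _ (ffact_le_exp n m)) // -bin_ffact leq_pmulr ?fact_gt0.
rewrite -[n in 'C(n, _)]card_ord -card_draws; apply/subset_leq_card/subsetP => F.
by rewrite !inE => /andP[].
Qed.

Lemma fact_exp_le t s : (t`! * t.+1 ^ s <= (t + s)`!)%N.
Proof.
elim: s => [|s IH]; first by rewrite muln1 addn0.
by rewrite addnS factS expnSr mulnA mulnC leq_mul // ltnS leq_addr.
Qed.

(** Factors up to [B] contribute at least 1, later ones at least (B+1+s)...(t+s) = (t+s)! /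
    (B+s)!. *)
Lemma prod_shift_ge (M : nat -> nat) B s t : (B <= t)%N ->
  (forall i, 0 < i <= t -> 0 < M i)%N -> (forall i, B <= i <= t -> i + s <= M i)%N ->
  ((t + s)`! <= (B + s)`! * \prod_(1 <= i < t.+1) M i)%N.
Proof.
elim: t => [|t IH] Bt M0 Ms.
  by move: Bt; rewrite leqn0 => /eqP ->; rewrite big_geq // muln1.
have [tB|Bt'] := ltnP t B.
  have -> : t.+1 = B by apply/eqP; rewrite eqn_leq tB Bt.
  rewrite leq_pmulr // big_nat_cond prodn_cond_gt0 // => i.
  by rewrite andbT ltnS => /andP[i0 iB]; apply: M0; rewrite i0 (leq_trans iB).
rewrite big_nat_recr //= mulnA addSn factS mulnC leq_mul //.
  by apply: IH => // i /andP[h1 h2]; [apply: M0 | apply: Ms]; rewrite h1 ltnW.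
by rewrite -addSn Ms // Bt leqnn.
Qed.

Theorem theorem4p4 :
  forall (d : nat), (0 < d)%N -> odd d ->
  forall (c : nat), exists N : nat,
  forall (k : fieldType) (n : nat) (G : {set {set 'I_n}}),
    homology_manifold k d G ->
    `|euler_char k G d|%N = c ->
    (N <= n)%N ->
    ((fvec G d.-1)%:R <
       (\prod_(1 <= i < (n - d).+1) Mmax k G i)%:R / ((n - d)`!)%:R :> rat)%R.
Proof.
move=> d d0 od c; set m := d./2.
have dm : d = m.*2.+1 by rewrite -[LHS]odd_double_half od.
have [m0|m0] := posnP m.
  (* For [d = 1] the Euler characteristic is the number of vertices, so [n] cannot exceed [c]. *)
  exists c.+1 => k n G hG chi cn; exfalso.
  have [[dG vG] _ Gd _] := hG.
  move: chi cn; rewrite (euler_charE k dG Gd) dm m0 big_ord1 mul1r absz_nat => <-.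
  apply/negP; rewrite -leqNgt -{1}(card_ord n) -(card_imset _ (@set1_inj 'I_n)).
  by apply/subset_leq_card/subsetP => _ /imsetP[v _ ->]; rewrite inE vG cards1.
have [C hC] := manifold_faces_bound m.
(* [D] will bound each f_i by a multiple of f_m, with f_m >= 1 absorbing the Euler characteristic;
   [B] bounds the vertices of some link, and [A] collects the constants of the final comparison. *)
pose D := (C * (c + m * 2 ^ m))%N; pose B := (m.+1 * D)%N.
pose A := (D * (B + m.+1)`! * 2 ^ m)%N.
exists (A + B + d.*2)%N => k n G hG chi nN.
(* In particular [n - d] is at least [d], so [n] is at most twice [n - d]. *)
have nd : (A + B + d <= n - d)%N by lia.
rewrite ltr_pdivlMr ?ltr0n ?fact_gt0 // -natrM ltr_nat /fvec prednK //.
rewrite dm in hG chi.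
have mG : (0 < #|faces G m|)%N.
  have [_ [F FG Fd] _ _] := hG.
  have [|E [_ EF Em]] := @subset_of_card _ set0 F m (sub0set _).
    by rewrite cards0 Fd; lia.
  apply/card_gt0P; exists E; rewrite inE Em eqxx andbT.
  by have [[dG _] _ _ _] := hG; apply: dG EF.
have fD i : (0 < i <= m.*2.+1)%N -> (#|faces G i| <= D * #|faces G m|)%N.
  move=> /(hC k n G hG)/leq_trans; apply; rewrite chi /D -mulnA leq_mul2l; apply/orP; right.
  by rewrite mulnDl -mulnA leq_add2r leq_pmulr.
have [|F + FB] := @exists_small_link k n _ G hG m B mG.
  by rewrite /B -mulnA leq_mul2l fD ?orbT //; lia.
rewrite inE => /andP[FG /eqP Fm].
have F0 : F != set0 by rewrite -card_gt0 Fm.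
set t := (n - d)%N in nd *.
have M0 i : (0 < i <= t)%N -> (0 < Mmax k G i)%N.
  move=> /andP[i0 it]; apply: leq_trans i0 _; apply: (Mmax_ge_index hG) => //.
  by rewrite -dm.
have Ms i : (B <= i <= t)%N -> (i + m.+1 <= Mmax k G i)%N.
  move=> /andP[Bi it]; have := @Mmax_ge_shift k n _ G hG F i FG F0.
  rewrite Fm (_ : (m.*2.+1 - m = m.+1)%N); last by lia.
  by apply; rewrite (leq_trans FB Bi) -dm.
have Bt : (B <= t)%N by lia.
have := prod_shift_ge Bt M0 Ms; set P := (\prod_(_ <= _ < _) _)%N => hP.
have := leq_trans (fact_exp_le t m.+1) hP => {}hP.
(* After multiplying by (B+m+1)! and cancelling t!, a constant times n^m is compared with
   (t+1)^(m+1). *)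
rewrite -(ltn_pmul2l (fact_gt0 (B + m.+1))); apply: leq_trans hP.
rewrite mulnA mulnC ltn_pmul2l ?fact_gt0 //.
have fd : (#|faces G d| <= D * n ^ m)%N.
  rewrite dm; apply: leq_trans (fD _ _) _; first by rewrite leqnn.
  exact: leq_mul (leqnn _) (card_faces_le _ _).
have n2 : (n ^ m <= 2 ^ m * t.+1 ^ m)%N.
  by rewrite -expnMn; case: (m) m0 => // l _; rewrite leq_exp2r //; lia.
apply: (@leq_ltn_trans (A * t.+1 ^ m)).
  apply: leq_trans (leq_mul (leqnn _) fd) _.
  rewrite mulnCA mulnA /A -[leqRHS]mulnA; exact: leq_mul (leqnn _) n2.
by rewrite expnS ltn_pmul2r ?expn_gt0 //; lia.
Qed.
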